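(* Let $\mathfrak g$ be a Lie algebra over $\mathbf k$, $D\in\mathrm{Der}(\mathfrak g)$ a derivation, $\lambda\in\mathbf k$ and $x\in\mathfrak g$. Then $$(\lambda\,\mathrm{ad}\,x+D)^n(x)=\sum_{i=1}^{n}\lambda^{i-1}\sum_{\alpha\vDash n+1,\ \ell(\alpha)=i}C_\alpha D^\alpha(x),\qquad n=1,\dots,p-1,$$ where $D^\alpha(x):=[D^{\alpha_1-1}(x),[\cdots,[D^{\alpha_{i-1}-1}(x),D^{\alpha_i-1}(x)]\cdots]]$ for $\alpha=(\alpha_1,\dots,\alpha_i)\vDash n+1$.
   Context: $\mathbf k$ is an algebraically closed field of prime characteristic $p$. $\alpha\vDash n$ means that $\alpha=(\alpha_1,\dots,\alpha_r)$ is a composition of $n$ (a tuple of positive integers with sum $n$), with length $\ell(\alpha)=r$, and $C_\alpha=\prod_{k=1}^r\binom{\alpha_1+\cdots+\alpha_k-1}{\alpha_k-1}$; equivalently $C_\alpha$ is the number of set partitions $(B_1,\dots,B_r)$ of $\{1,\dots,n\}$ with $\max B_1<\cdots<\max B_r$ and $|B_k|=\alpha_k$. For $i=1$, $D^{(n+1)}(x)=D^n(x)$; $\lambda^0=1$. *)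

(* Defs.v *)
From HB Require Import structures.
From mathcomp Require Import all_boot all_order all_algebra.

Set Implicit Arguments.
Unset Strict Implicit.
Unset Printing Implicit Defensive.

Import GRing.Theory.
Local Open Scope ring_scope.

(* The bracket is alternating (not just skew-symmetric), as required in
   characteristic 2. No finite-dimensionality is assumed. *)
HB.mixin Record Lmodule_isLieAlgebra (R : comNzRingType) (L : Type)
    of GRing.Lmodule R L := {
  lie : L -> L -> L;
  lie_linearl : forall y : L, linear (fun x : L => lie x y);
  lie_linearr : forall x : L, linear (lie x);
  lie_alternating : forall x : L, lie x x = 0;
  lie_jacobi : forall x y z : L,
    lie x (lie y z) + lie y (lie z x) + lie z (lie x y) = 0
}.

#[short(type="lieAlgType")]
HB.structure Definition LieAlgebra (R : comNzRingType) :=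
  { L of GRing.Lmodule R L & Lmodule_isLieAlgebra R L }.

Definition ad (R : comNzRingType) (L : lieAlgType R) (x : L) : L -> L :=
  fun y => lie x y.

(* The k-linearity of a derivation is carried by the type of D. *)
Definition is_derivation (R : comNzRingType) (L : lieAlgType R)
    (D : {linear L -> L}) : Prop :=
  forall x y : L, D (lie x y) = lie (D x) y + lie x (D y).

Definition is_composition (n : nat) (alpha : seq nat) : bool :=
  all (leq 1) alpha && (sumn alpha == n).

(* C_alpha = prod_k binom(alpha_1 + ... + alpha_k - 1, alpha_k - 1); the index
   k starts at 0 here. *)
Definition compC (alpha : seq nat) : nat :=
  (\prod_(k < size alpha)
     'C((sumn (take k.+1 alpha)).-1, (nth 0 alpha k).-1))%N.

(* D^alpha(x), the right-nested bracket of the D^(alpha_k - 1)(x); the value on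
   the empty sequence is junk. *)
Fixpoint Dcomp (R : comNzRingType) (L : lieAlgType R) (D : L -> L)
    (alpha : seq nat) (x : L) : L :=
  match alpha with
  | [::] => 0
  | [:: a] => iter a.-1 D x
  | a :: alpha' => lie (iter a.-1 D x) (Dcomp D alpha' x)
  end.

(* Compositions of n of length i are represented as i-tuples over 'I_n.+1,
   since each part is at most n. *)
Definition comp_of (n i : nat) (alpha : i.-tuple 'I_n.+1) : seq nat :=
  [seq val a | a <- alpha].

(* Main.v *)
(** Let S(i, n) be the sum of the C_alpha D^alpha(x) over the compositions
    alpha of n of length i. By the Leibniz rule, D acts on D^alpha(x) by
    increasing one part of alpha, while ad x prepends a part equal to 1; the
    matching recurrence for the coefficients C_alpha gives
    S(i+1, n+1) = D S(i+1, n) + [x, S(i, n)], whence the formula by induction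
    on n, over any commutative ring. The term of length n + 1 is a multiple of
    the iterated bracket of x with itself, so it vanishes. *)

Require Import Defs.
From HB Require Import structures.
From mathcomp Require Import all_boot all_order all_algebra.
From mathcomp Require Import zify.

Set Implicit Arguments.
Unset Strict Implicit.
Unset Printing Implicit Defensive.

Import GRing.Theory.
Local Open Scope ring_scope.

HB.instance Definition _ (R : comNzRingType) (L : lieAlgType R) (x : L) :=
  GRing.isLinear.Build R L L *:%R (lie x) (lie_linearr x).

Definition comps (i n : nat) : seq (seq nat) :=
  [seq comp_of alpha | alpha <- enum {: i.-tuple 'I_n.+1}
                     & is_composition n (comp_of alpha)].

Lemma big_comps (V : nmodType) (i n : nat) (F : seq nat -> V) :
  \sum_(alpha : i.-tuple 'I_n.+1 | is_composition n (comp_of alpha))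
     F (comp_of alpha) = \sum_(beta <- comps i n) F beta.
Proof. by rewrite /comps big_map big_filter big_enum_cond. Qed.

Lemma comps_uniq (i n : nat) : uniq (comps i n).
Proof.
rewrite map_inj_uniq; first by apply/filter_uniq/enum_uniq.
by move=> a b /(inj_map val_inj)/val_inj.
Qed.

Lemma mem_leq_sumn (s : seq nat) (a : nat) : a \in s -> (a <= sumn s)%N.
Proof.
elim: s => //= b s IHs; rewrite inE => /orP[/eqP -> | /IHs]; lia.
Qed.

Lemma mem_comps (i n : nat) (beta : seq nat) :
  (beta \in comps i n) = (size beta == i) && is_composition n beta.
Proof.
apply/mapP/andP => [[alpha] | [/eqP <- beta_n]].
  by rewrite mem_filter => /andP[alpha_n _] ->; rewrite size_map size_tuple.
have betaE : comp_of (map_tuple (@inord n) (in_tuple beta)) = beta.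
  rewrite /comp_of -map_comp -[RHS]map_id; apply/eq_in_map => a a_beta /=.
  rewrite inordK // ltnS; case/andP: beta_n => _ /eqP <-.
  exact: mem_leq_sumn.
exists (map_tuple (@inord n) (in_tuple beta)); last by rewrite betaE.
by rewrite mem_filter betaE beta_n mem_enum.
Qed.

Lemma size_leq_sumn (s : seq nat) : all (leq 1) s -> (size s <= sumn s)%N.
Proof. elim: s => //= a s IHs /andP[a_gt0 /IHs]; lia. Qed.

Lemma comps_small (i n : nat) : (n < i)%N -> comps i n = [::].
Proof.
move=> lt_ni; apply: size0nil; case E: (comps i n) => [//|beta s].
have: beta \in comps i n by rewrite E mem_head.
rewrite mem_comps => /and3P[/eqP si /size_leq_sumn + /eqP sn]; lia.
Qed.

Lemma comps0 (n : nat) : comps 0 n.+1 = [::].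
Proof.
apply: size0nil; case E: (comps 0 n.+1) => [//|beta s].
have: beta \in comps 0 n.+1 by rewrite E mem_head.
by rewrite mem_comps size_eq0 => /and3P[/eqP -> _].
Qed.

Lemma composition_ones (s : seq nat) :
  all (leq 1) s -> sumn s = size s -> s = nseq (size s) 1%N.
Proof.
elim: s => //= a s IHs /andP[a_gt0 s_gt0] sE.
have le_s := size_leq_sumn s_gt0.
by rewrite -IHs //; [congr cons|]; lia.
Qed.

Definition decr_nth (s : seq nat) (j : nat) : seq nat :=
  set_nth 0%N s j (nth 0%N s j).-1.

Lemma size_decr_nth (s : seq nat) (j : nat) :
  (j < size s)%N -> size (decr_nth s j) = size s.
Proof. by move=> js; rewrite size_set_nth; apply/maxn_idPr. Qed.

Lemma incr_nthK (s : seq nat) (j : nat) :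
  (j < size s)%N -> decr_nth (incr_nth s j) j = s.
Proof.
move=> js; have si : size (incr_nth s j) = size s by rewrite size_incr_nth js.
apply: (@eq_from_nth _ 0%N); rewrite size_decr_nth ?si // => k _.
rewrite nth_set_nth /= !nth_incr_nth eqxx.
by case: (eqVneq k j) => [->|]; rewrite // eq_sym => /negPf ->.
Qed.

Lemma decr_nthK (s : seq nat) (j : nat) :
  (0 < nth 0 s j)%N -> incr_nth (decr_nth s j) j = s.
Proof.
move=> sj_gt0; have js : (j < size s)%N.
  by rewrite ltnNge; apply: contraL sj_gt0 => ?; rewrite nth_default.
apply: (@eq_from_nth _ 0%N); rewrite size_incr_nth size_decr_nth js // => k _.
rewrite nth_incr_nth nth_set_nth /= eq_sym.
by case: eqVneq => [->|//]; rewrite add1n prednK.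
Qed.

Lemma sumn_incr_nth (s : seq nat) (j : nat) :
  (j < size s)%N -> sumn (incr_nth s j) = (sumn s).+1.
Proof. by elim: s j => [|a s IHs] [|j] //= js; rewrite IHs // addnS. Qed.

Lemma all_positiveP (s : seq nat) :
  reflect (forall j, j < size s -> 0 < nth 0 s j)%N (all (leq 1) s).
Proof. exact: all_nthP. Qed.

Lemma perm_incr_comps (i m j : nat) : (j < i)%N ->
  perm_eq [seq incr_nth alpha j | alpha <- comps i m]
          [seq beta <- comps i m.+1 | (1 < nth 0 beta j)%N].
Proof.
move=> ji; apply: uniq_perm; last 1 first.
- move=> beta; rewrite mem_filter mem_comps; apply/mapP/idP.
    case=> alpha; rewrite mem_comps => /and3P[/eqP si /all_positiveP pos /eqP sm].
    move=> ->; rewrite nth_incr_nth eqxx ltnS pos ?si //=.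
    rewrite size_incr_nth si ji eqxx /= /is_composition.
    rewrite sumn_incr_nth ?si // sm eqxx andbT.
    apply/all_positiveP => l; rewrite size_incr_nth si ji => li.
    by rewrite nth_incr_nth addn_gt0 pos ?si // orbT.
  case/and4P=> bj_gt1 /eqP si /all_positiveP pos /eqP sm.
  have bE : incr_nth (decr_nth beta j) j = beta by rewrite decr_nthK // ltnW.
  have sd : size (decr_nth beta j) = i by rewrite size_decr_nth si.
  exists (decr_nth beta j) => //; rewrite mem_comps sd eqxx /=.
  apply/andP; split; last first.
    by rewrite -eqSS -(@sumn_incr_nth _ j) ?sd // bE sm.
  apply/all_positiveP => l; rewrite sd => li; rewrite nth_set_nth /=.
  by case: eqP => [_|_]; [rewrite -ltnS prednK // ltnW | rewrite pos ?si].
- rewrite map_inj_in_uniq ?comps_uniq // => a b.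
  rewrite !mem_comps => /andP[/eqP sa _] /andP[/eqP sb _] eq_ab.
  by rewrite -(@incr_nthK a j) ?sa // eq_ab incr_nthK ?sb.
- by rewrite filter_uniq // comps_uniq.
Qed.

Lemma perm_cons1_comps (i m : nat) :
  perm_eq [seq 1%N :: alpha | alpha <- comps i m]
          [seq beta <- comps i.+1 m.+1 | head 0%N beta == 1%N].
Proof.
apply: uniq_perm.
- by rewrite map_inj_uniq ?comps_uniq // => a b [].
- by rewrite filter_uniq // comps_uniq.
move=> beta; rewrite mem_filter mem_comps; apply/mapP/idP.
  by case=> alpha; rewrite mem_comps /is_composition => aP -> /=.
case: beta => [|b beta] //= /andP[/eqP -> bP].
by exists beta => //; rewrite mem_comps.
Qed.

Lemma compC_rcons (s : seq nat) (a : nat) :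
  compC (rcons s a) = (compC s * 'C((sumn s + a).-1, a.-1))%N.
Proof.
rewrite /compC size_rcons big_ord_recr /=; congr muln.
  apply: eq_bigr => k _; rewrite -cats1 takel_cat; last exact: ltn_ord.
  by rewrite nth_cat ltn_ord.
rewrite nth_rcons ltnn eqxx take_oversize ?size_rcons //.
by rewrite -cats1 sumn_cat /= addn0.
Qed.

Lemma decr_nth_rcons (s : seq nat) (a j : nat) :
  (j < size s)%N -> decr_nth (rcons s a) j = rcons (decr_nth s j) a.
Proof.
rewrite /decr_nth; elim: s j => [|b s IHs] [|j] //=.
by rewrite ltnS => /IHs ->.
Qed.

Lemma decr_nth_rcons_last (s : seq nat) (a : nat) :
  decr_nth (rcons s a) (size s) = rcons s a.-1.
Proof.
by rewrite /decr_nth nth_rcons ltnn eqxx; elim: s => //= b s ->.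
Qed.

(* Set-partition count behind the identity: in a partition of {1, ..., n} with
   blocks ordered by their maxima, either the element 1 can be removed from a
   block with at least two elements, or {1} is the first block. *)
Lemma compC_rec (s : seq nat) : s != [::] -> all (leq 1) s ->
  compC s = (\sum_(j < size s | 1 < nth 0 s j) compC (decr_nth s j)
             + (if head 0 s == 1 then compC (behead s) else 0))%N.
Proof.
elim/last_ind: s => // s a IHs _; rewrite all_rcons => /andP[a_gt0 s_gt0].
rewrite size_rcons big_mkcond big_ord_recr /=.
rewrite nth_rcons ltnn eqxx decr_nth_rcons_last.
case: (eqVneq s [::]) => [->|s_neq0].
  rewrite big_ord0 /=; case: a a_gt0 => [//|[|a]] _;
    by rewrite /compC /= ?big_ord_recl !big_ord0 /= ?addn0 ?binn.
have s_pos : (0 < sumn s)%N.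
  by apply: leq_trans (size_leq_sumn s_gt0); rewrite lt0n size_eq0.
have headE : (if head 0 (rcons s a) == 1 then compC (behead (rcons s a)) else 0)%N
  = ((if head 0 s == 1 then compC (behead s) else 0)
      * 'C((sumn s + a).-2, a.-1))%N.
  case: s s_neq0 {IHs s_gt0 s_pos} => //= b s _.
  by case: eqP => [->|]; rewrite ?mul0n // compC_rcons.
have sumE : (\sum_(j < size s) (if 1 < nth 0 (rcons s a) j
                  then compC (decr_nth (rcons s a) j) else 0)
  = (\sum_(j < size s | 1 < nth 0 s j) compC (decr_nth s j))
      * 'C((sumn s + a).-2, a.-1))%N.
  rewrite big_distrl /= [RHS]big_mkcond /=; apply: eq_bigr => j _.
  rewrite nth_rcons ltn_ord; case: ifP => // sj.
  have decrS := @sumn_incr_nth (decr_nth s j) j.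
  rewrite decr_nthK ?size_decr_nth // in decrS; last exact: ltnW.
  by rewrite decr_nth_rcons // compC_rcons decrS.
rewrite headE sumE addnAC -mulnDl -IHs // !compC_rcons.
case: a a_gt0 {headE sumE} => [//|[|a]] _ /=; first by rewrite !bin0 addn0.
by rewrite !addnS /= binS mulnDr.
Qed.

Section LieAlgebra.

Variables (R : comNzRingType) (L : lieAlgType R) (D : {linear L -> L}) (x : L).

Definition Dsum (i n : nat) : L :=
  \sum_(alpha <- comps i n) Dcomp D alpha x *+ compC alpha.

Lemma Dcomp_cons (a : nat) (alpha : seq nat) : alpha != [::] ->
  Dcomp D (a :: alpha) x = lie (iter a.-1 D x) (Dcomp D alpha x).
Proof. by case: alpha. Qed.

Lemma Dcomp_ones (n : nat) : Dcomp D (nseq n.+2 1%N) x = 0.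
Proof.
elim: n => [|n IHn]; first exact: lie_alternating.
by rewrite Dcomp_cons // IHn linear0.
Qed.

Lemma derivation_Dcomp (alpha : seq nat) :
  is_derivation D -> all (leq 1) alpha ->
  D (Dcomp D alpha x) = \sum_(j < size alpha) Dcomp D (incr_nth alpha j) x.
Proof.
move=> hD; elim: alpha => [|a alpha IHalpha]; first by rewrite big_ord0 linear0.
case/andP=> a_gt0 pos; rewrite big_ord_recl [incr_nth _ ord0]/=.
have iterS : D (iter a.-1 D x) = iter a D x by rewrite -iterS prednK.
case: (eqVneq alpha [::]) => [->|alpha_neq0]; first by rewrite big_ord0 addr0.
rewrite !Dcomp_cons // hD iterS IHalpha //; congr (_ + _).
rewrite linear_sum; apply: eq_bigr => j _; rewrite [incr_nth _ _]/= Dcomp_cons //.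
by rewrite -size_eq0 size_incr_nth ltn_ord -lt0n (leq_trans _ (ltn_ord j)).
Qed.

Lemma derivation_Dsum (i n : nat) : is_derivation D ->
  D (Dsum i n) =
  \sum_(beta <- comps i n.+1)
     \sum_(j < i | (1 < nth 0 beta j)%N)
        Dcomp D beta x *+ compC (decr_nth beta j).
Proof.
move=> hD; rewrite linear_sum big_seq_cond.
under eq_bigr => alpha.
  rewrite andbT mem_comps => /and3P[/eqP si pos _].
  rewrite raddfMn /= derivation_Dcomp // si -sumrMnl.
  over.
rewrite -big_seq_cond exchange_big [RHS](exchange_big_dep xpredT) //=.
apply: eq_bigr => j _.
rewrite -[RHS]big_filter -(perm_big _ (perm_incr_comps n (ltn_ord j))) [RHS]big_map.
rewrite !big_seq; apply: eq_bigr => alpha; rewrite mem_comps => /andP[/eqP si _].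
by rewrite incr_nthK // si.
Qed.

Lemma ad_Dsum (i n : nat) :
  ad x (Dsum i n.+1) =
  \sum_(beta <- comps i.+1 n.+2)
     Dcomp D beta x *+ (if head 0%N beta == 1%N then compC (behead beta) else 0%N).
Proof.
rewrite /ad linear_sum /=; under [RHS]eq_bigr => beta _ do rewrite fun_if mulr0n.
rewrite -[RHS]big_mkcond -[RHS]big_filter -(perm_big _ (perm_cons1_comps i n.+1)) [RHS]big_map.
rewrite !big_seq; apply: eq_bigr => alpha; rewrite mem_comps => /and3P[_ _ /eqP sn].
by rewrite raddfMn Dcomp_cons //; apply: contra_eq_neq sn => ->.
Qed.

Lemma Dsum_rec (i n : nat) : is_derivation D ->
  Dsum i.+1 n.+2 = D (Dsum i.+1 n.+1) + ad x (Dsum i n.+1).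
Proof.
move=> hD; rewrite derivation_Dsum // ad_Dsum -big_split /= /Dsum.
rewrite !big_seq; apply: eq_bigr => beta; rewrite mem_comps.
case/and3P=> /eqP si pos _; rewrite compC_rec //; last by case: beta si {pos}.
by rewrite si mulrnDr sumrMnr.
Qed.

Lemma Dsum0 (n : nat) : Dsum 0 n.+1 = 0.
Proof. by rewrite /Dsum comps0 big_nil. Qed.

Lemma Dsum_small (i n : nat) : (n < i)%N -> Dsum i n = 0.
Proof. by move=> lt_ni; rewrite /Dsum comps_small // big_nil. Qed.

Lemma Dsum_diag (n : nat) : Dsum n.+2 n.+2 = 0.
Proof.
rewrite /Dsum big_seq big1 // => alpha; rewrite mem_comps => /and3P[/eqP si pos].
move/eqP => sn; rewrite (composition_ones pos) ?si //.
by rewrite Dcomp_ones mul0rn.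
Qed.

Lemma Dsum11 : Dsum 1 1 = x.
Proof.
have: perm_eq (comps 1 1) [:: [:: 1%N]].
  apply: uniq_perm; rewrite ?comps_uniq // => beta; rewrite mem_comps inE.
  case: beta => [|b [|c beta]] /=; rewrite ?eqseq_cons ?andbF //.
  by rewrite /is_composition /= addn0 andbT; case: b => [|[|b]].
move/(perm_big _)=> E; rewrite /Dsum E big_seq1 /compC /=.
by rewrite big_ord_recl big_ord0.
Qed.

Lemma iter_ad_derivation (lambda : R) (n : nat) : is_derivation D ->
  iter n ((lambda \*: ad x) \+ D) x =
  \sum_(i < n.+1) lambda ^+ i *: Dsum i.+1 n.+1.
Proof.
move=> hD; elim: n => [|n IHn].
  by rewrite big_ord_recl big_ord0 addr0 expr0 scale1r Dsum11.
rewrite iterS IHn /=.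
under [RHS]eq_bigr => i _ do rewrite Dsum_rec // scalerDr.
rewrite big_split /= [RHS]addrC; congr (_ + _).
  rewrite [RHS]big_ord_recl Dsum0 /ad linear0 scaler0 add0r /= linear_sum scaler_sumr.
  by apply: eq_bigr => i _; rewrite linearZ /= scalerA -exprS.
rewrite [RHS]big_ord_recr /= Dsum_small // linear0 scaler0 addr0.
by rewrite linear_sum; apply: eq_bigr => i _; rewrite linearZ.
Qed.

End LieAlgebra.

Theorem lemma4p6 (k : closedFieldType) (p : nat) (hp : p \in [pchar k])
    (g : lieAlgType k) (D : {linear g -> g}) (hD : is_derivation D)
    (lambda : k) (x : g) (n : nat) (hn : (1 <= n <= p - 1)%N) :
  iter n ((lambda \*: ad x) \+ D) x =
  \sum_(1 <= i < n.+1)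
    lambda ^+ (i - 1) *:
      \sum_(alpha : i.-tuple 'I_n.+2 | is_composition n.+1 (comp_of alpha))
        Dcomp D (comp_of alpha) x *+ compC (comp_of alpha).
Proof.
case: n hn => // n _; rewrite iter_ad_derivation // big_ord_recr /=.
rewrite Dsum_diag scaler0 addr0 big_add1 big_mkord.
apply: eq_bigr => i _; rewrite subn1 /=; congr (_ *: _).
by rewrite (big_comps _ _ (fun alpha => Dcomp D alpha x *+ compC alpha)).
Qed.
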